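(* Let $X$ be a regular space. Then $\mathsf{S}_{\mathrm{bnd}}(\mathcal{O},\mathcal{O})$ holds over $X$ if, and only if, there is a compact set $K\subset X$ such that, for every open set $V\supset K$, $\mathsf{S}_1(\mathcal{O},\mathcal{O})$ holds over the subspace $X\setminus V$.
   Context: Here $\omega=\{0,1,2,\dots\}$. $\mathcal{O}$ denotes the set of open covers of the space under consideration; a property holding ''over $Y$'' means that it holds with $\mathcal{O}$ the set of open covers of $Y$ (with the subspace topology if $Y\subset X$). $\mathsf{S}_1(\mathcal{O},\mathcal{O})$ holds if for every sequence $\langle A_n:n\in\omega\rangle$ of elements of $\mathcal{O}$ there is a sequence $\langle B_n:n\in\omega\rangle$ such that $B_n\subset A_n$ and $|B_n|\le 1$ for every $n\in\omega$, and $\bigcup_{n\in\omega}B_n\in\mathcal{O}$. $\mathsf{S}_{\mathrm{bnd}}(\mathcal{O},\mathcal{O})$ holds if for every sequence $\langle A_n:n\in\omega\rangle$ of elements of $\mathcal{O}$ there are a sequence $\langle B_n:n\in\omega\rangle$ and a $k\in\omega$ such that $B_n\subset A_n$ is finite with $|B_n|\le k$ for every $n\in\omega$, and $\bigcup_{n\in\omega}B_n\in\mathcal{O}$. *)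

(* Defs.v *)
From HB Require Import structures.
From mathcomp Require Import all_boot all_order all_algebra.
From mathcomp Require Import all_classical all_reals all_analysis.

Set Implicit Arguments.
Unset Strict Implicit.
Unset Printing Implicit Defensive.

Local Open Scope classical_set_scope.
Local Open Scope card_scope.

Definition open_cover (T : topologicalType) : set (set (set T)) :=
  [set A | A `<=` open /\ \bigcup_(U in A) U = [set: T]].

(* The cardinal inequalities [B n #<= `I_k] say that [B n] has at most [k]
   elements; in particular they make [B n] finite. *)

Definition selection_one (T : Type) (P Q : set (set T)) : Prop :=
  forall A : nat -> set T, (forall n, P (A n)) ->
  exists B : nat -> set T,
    (forall n, B n `<=` A n /\ B n #<= `I_1) /\ Q (\bigcup_n B n).

Definition selection_bnd (T : Type) (P Q : set (set T)) : Prop :=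
  forall A : nat -> set T, (forall n, P (A n)) ->
  exists (B : nat -> set T) (k : nat),
    (forall n, B n `<=` A n /\ B n #<= `I_k) /\ Q (\bigcup_n B n).

Definition S_one (T : topologicalType) : Prop :=
  selection_one (@open_cover T) (@open_cover T).

Definition S_bnd (T : topologicalType) : Prop :=
  selection_bnd (@open_cover T) (@open_cover T).

(* Main.v *)
Require Import Defs.
From HB Require Import structures.
From mathcomp Require Import finmap.
From mathcomp Require Import all_boot all_order all_algebra.
From mathcomp Require Import all_classical all_reals all_analysis.

Local Open Scope classical_set_scope.

(** The easy direction spends the whole bound on one step.  A compact [K] is
    covered by a finite part [F] of the first cover; off the union [V] of [F],
    one set from each cover is enough, so at most [#|F| + 1] sets are taken
    from each cover ([S_bnd_of_compact]).

    For the converse, [K] is the set of points none of whose neighbourhoods has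
    a closure on which the one-set selection works ([rothberger_kernel]).
    A space with bounded selections is Lindelof, and the one-set selection
    passes to closed subsets and to countable unions, so it works off every
    open [V] containing [K] ([rothberger_off_kernel]).

    Compactness of [K] rests on [S_bnd_escape]: if open sets [U 0, U 1, ...]
    cover the space, the one-set selection works off finitely many of them.
    Otherwise it fails on every [C n], the complement of the first [n].  Cut the
    covers that witness the failure on [C n] into blocks of [n + 1], and let
    the [m]-th cover of the space consist of the open sets that, for every [n],
    are small on [C n] with respect to every cover of the [m]-th block for [n].
    These do cover, because each point lies in some [U p], which meets only
    finitely many of the [C n].  A selection of at most [k] sets from each
    then gives, on [C k], one set for each cover of each block, a contradiction.

    If now a filter containing [K] had no cluster point in [K], regularity would
    provide a countable open cover by sets [U i] whose closures each miss some
    element of the filter.  Off finitely many of the [U i] the one-set selection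
    works, so by definition of [K] their closures cover [K]; then the filter
    contains the empty set. *)

(** * One-set selections for subsets of a space *)

(** The property [S_one] of the subspace [C], expressed with open sets of the
    ambient space.  The value [set0] stands for selecting nothing, which is
    forced when [C] and a cover of it are empty. *)
Definition rothberger {X : topologicalType} (C : set X) : Prop :=
  forall A : nat -> set (set X), (forall n, A n `<=` open) ->
  (forall n, C `<=` \bigcup_(U in A n) U) ->
  exists b : nat -> set X,
    (forall n, (set0 |` A n) (b n)) /\ C `<=` \bigcup_n b n.

Lemma card_le_II_image {T : pointedType} (B : set T) (k : nat) :
  (B #<= `I_k)%card -> exists g : nat -> T, B `<=` g @` `I_k.
Proof. by move=> /pcard_geP[g]; exists g; exact: surj. Qed.

Lemma rothberger_S_one {X : topologicalType} (C : set X) :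
  rothberger C <-> S_one (set_type C).
Proof.
split=> [rC A Acov | SC A Aop Acov].
- pose A' n := [set W : set X | open W /\ A n (set_val @^-1` W)].
  have [|n x Cx|b [bA bC]] := rC A'; first by move=> n W [].
    have [Aop Aeq] := Acov n.
    have : [set: set_type C] (SigSub (mem_set Cx)) by [].
    rewrite -Aeq => -[U AU Ux].
    have [W oW WU] : exists2 W : set X, open W & set_val @^-1` W = U.
      by have [W oW WU] := Aop _ AU; exists W.
    by exists W; [split; rewrite ?WU|move: Ux; rewrite -WU].
  exists (fun n => [set U | U = set_val @^-1` b n /\ A n U]); split.
    move=> n; split=> [U []//|].
    apply: (@card_le_trans _ _ _ [set set_val @^-1` b n]).
      by apply: subset_card_le => U [].
    by rewrite (card_le_eql card_set1).
  split=> [U [n _ [_ AU]]|]; first exact: (Acov n).1.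
  apply/seteqP; split=> // x _; have [n _ bx] := bC _ (set_valP x).
  have := bA n; case=> [b0|[_ Ab]]; first by rewrite b0 in bx.
  by exists (set_val @^-1` b n) => //; exists n.
- pose A' n := [set (set_val @^-1` W : set (set_type C)) | W in A n].
  have [n|B [BA [_ Beq]]] := SC A'.
    split=> [_ [W AW <-]|]; first by exists W => //; exact: Aop AW.
    apply/seteqP; split=> // x _; have [W AW Wx] := Acov n _ (set_valP x).
    by exists (set_val @^-1` W) => //; exists W.
  have /choice[b bP] n : exists b : set X, (set0 |` A n) b /\
      forall U, B n U -> U = set_val @^-1` b.
    have [[U BU]|nB] := pselect (B n !=set0); last first.
      by exists set0; split=> [|U BU]; [left|case: nB; exists U].
    have [W AW WU] := (BA n).1 _ BU; exists W; split=> [|U']; first by right.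
    have [g gB] := card_le_II_image _ _ (BA n).2.
    rewrite WU => /gB[[|//] _ <-]; by have [[|//] _ <-] := gB _ BU.
  exists b; split=> [n|x Cx]; first by have [] := bP n.
  have : [set: set_type C] (SigSub (mem_set Cx)) by [].
  rewrite -Beq => -[U [n _ BU] Ux]; exists n => //.
  by have [_ /(_ _ BU) Ub] := bP n; move: Ux; rewrite Ub.
Qed.

(** Enlarge each member of a cover of [D] by the open complement of [D]: this
    gives a cover of [C] and changes nothing on [D]. *)
Lemma rothberger_closed {X : topologicalType} (C D : set X) :
  closed D -> D `<=` C -> rothberger C -> rothberger D.
Proof.
move=> cD DC rC A Aop Acov.
pose A' n := [set V `|` ~` D | V in set0 |` A n].
have [n|n x Cx|b [bA bC]] := rC A'.
- move=> _ [V AV <-]; apply: openU; last exact: closed_openC.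
  by case: AV => [->|/Aop//]; exact: open0.
- have [Dx|nDx] := pselect (D x).
    have [V AV Vx] := Acov n _ Dx.
    by exists (V `|` ~` D); [exists V => //; right|left].
  by exists (set0 `|` ~` D); [exists set0 => //; left|right].
have /choice[v vP] n : exists V, (set0 |` A n) V /\ b n `<=` V `|` ~` D.
  have [->|[V AV <-]] := bA n; last by exists V; split.
  by exists set0; split=> [|y []]; left.
exists v; split=> [n|x Dx]; first by have [] := vP n.
have [n _ bx] := bC _ (DC _ Dx); exists n => //.
by case: ((vP n).2 _ bx).
Qed.

Lemma rothberger0 {X : topologicalType} : rothberger (@set0 X).
Proof. by move=> A _ _; exists (fun=> set0); split=> // n; left. Qed.

(** Split the sequence of covers into infinitely many subsequences along the
    coding of pairs of integers, and use the [i]-th one to cover [C i]. *)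
Lemma rothberger_bigcup {X : topologicalType} (C : nat -> set X) :
  (forall i, rothberger (C i)) -> rothberger (\bigcup_i C i).
Proof.
move=> rC A Aop Acov.
have /choice[b bP] i : exists b : nat -> set X,
    (forall m, (set0 |` A (pickle (i, m))) (b m)) /\ C i `<=` \bigcup_m b m.
  apply: rC => m; first exact: Aop.
  by move=> x Cx; apply: Acov; exists i.
exists (fun n => if @pickle_inv (nat * nat)%type n is Some (i, m) then b i m else set0); split.
  move=> n; case E: pickle_inv => [[i m]|]; last by left.
  have := @pickle_invK (nat * nat)%type n; rewrite E /= => <-.
  exact: (bP i).1.
move=> x [i _ Cx]; have [m _ bx] := (bP i).2 _ Cx.
by exists (pickle (i, m)) => //; rewrite pickleK_inv.
Qed.

(** * Consequences of bounded selections *)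

(** Bounded selections from a constant sequence give the Lindelof property; the
    empty set pads the enumeration. *)
Lemma S_bnd_countable_subcover {X : topologicalType} (A : set (set X)) :
  S_bnd X -> open_cover A -> A set0 ->
  exists U : nat -> set X, (forall n, A (U n)) /\ \bigcup_n U n = [set: X].
Proof.
move=> SX Acov A0; have [//|B [k [BA [_ Bcov]]]] := SX (fun=> A).
have /choice[g gP] n : exists g : nat -> set X, B n `<=` g @` `I_k.
  exact: card_le_II_image (BA n).2.
pose u i m := if `[< A (g i m) >] then g i m else set0.
exists (fun n => if @pickle_inv (nat * nat)%type n is Some (i, m) then u i m else set0).
split=> [n|].
  by case: pickle_inv => [[i m]|//]; rewrite /u; case: ifP => // /asboolP.
apply/seteqP; split=> // x _; move: (I : [set: X] x); rewrite -Bcov.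
move=> [V [i _ BV] Vx]; have [m _ gV] := gP _ _ BV.
exists (pickle (i, m)) => //; rewrite pickleK_inv /u gV.
by case: ifP => // /asboolP; case; exact: (BA i).1.
Qed.

(** The heart of the proof: bounded selections cannot let the one-set selection
    fail on all the closed sets [C n] of a locally finite decreasing sequence,
    since the failure on [C n] can be amplified to a failure of selections of
    [n] sets. *)
Lemma S_bnd_escape {X : topologicalType} (U : nat -> set X) :
  S_bnd X -> (forall n, open (U n)) -> \bigcup_n U n = [set: X] ->
  exists n, rothberger (~` \bigcup_(i < n) U i).
Proof.
move=> SX oU Ucov; pose C n := ~` \bigcup_(i < n) U i.
have cC n : closed (C n) by apply: open_closedC; apply: bigcup_open.
apply: contrapT => /forallNP nr.
have /choice[A AP] n : exists A : nat -> set (set X),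
    [/\ forall i, A i `<=` open, forall i, C n `<=` \bigcup_(V in A i) V &
      ~ exists b : nat -> set X,
        (forall i, (set0 |` A i) (b i)) /\ C n `<=` \bigcup_i b i].
  have /existsNP[A /not_implyP[Aop /not_implyP[Acov nb]]] := nr n.
  by exists A.
(* The [i]-th bad cover of [C n] belongs to the block [i %/ n.+1]; blocks of
   size [n.+1] rather than [n] avoid a division by zero at [n = 0]. *)
pose R m := [set W : set X | open W /\ forall n i, i %/ n.+1 = m ->
  exists V, (set0 |` A n i) V /\ W `&` C n `<=` V].
have [m|B [k [BR [_ Bcov]]]] := SX R.
  split=> [W []//|]; apply/seteqP; split=> // x _.
  move: (I : [set: X] x); rewrite -Ucov => -[p _ Ux].
  have /choice[V VP] (ni : nat * nat) : exists V : set X,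
      (set0 |` A ni.1 ni.2) V /\ (C ni.1 x -> V x).
    have [Cx|nCx] := pselect (C ni.1 x); last by exists set0; split=> //; left.
    have [_ Acov _] := AP ni.1; have [V AV Vx] := Acov ni.2 _ Cx.
    by exists V; split=> //; right.
  have oV ni : open (V ni).
    have [Aop _ _] := AP ni.1.
    by have [[->|AV] _] := VP ni; [exact: open0|exact: Aop AV].
  (* The trace of [U p] on [C n] is empty for [p < n], so only the pairs
     [(n, i)] with [n <= p] and [i] in the [m]-th block matter. *)
  pose F := `I_p.+1 `*` `I_(m.+1 * p.+1).
  exists (U p `&` ~` \bigcup_(ni in F) (C ni.1 `\` V ni)).
    split=> [|n i im].
      apply: openI => //; apply: closed_openC; apply: closed_bigcup.
        by apply: finite_setX; exact: finite_II.
      by move=> ni _; apply: closedI => //; exact: open_closedC.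
    exists (V (n, i)); split=> [|y [[Uy nCVy] Cy]]; first exact: (VP (n, i)).1.
    apply: contrapT => nVy; apply: nCVy; exists (n, i) => //; split=> /=.
      by rewrite ltnS leqNgt; apply/negP => pn; apply: Cy; exists p.
    have np : n <= p.
      by rewrite leqNgt; apply/negP => pn; apply: Cy; exists p.
    apply: (@leq_trans (m.+1 * n.+1)); last by rewrite leq_mul2l.
    by rewrite -im; exact: ltn_ceil.
  by split=> // -[ni _ [Cx]]; apply; exact: (VP ni).2.
have /choice[g gP] m : exists g : nat -> set X, B m `<=` g @` `I_k.
  exact: card_le_II_image (BR m).2.
(* The [j]-th set chosen from the [m]-th cover serves the bad cover of [C k]
   with index [m * k.+1 + j], the [j]-th one of the [m]-th block. *)
have [_ _] := AP k; apply.
have /choice[b bP] i : exists V, (set0 |` A k i) V /\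
    let W := g (i %/ k.+1) (i %% k.+1) in B (i %/ k.+1) W -> W `&` C k `<=` V.
  set W := g _ _.
  have [BW|nBW] := pselect (B (i %/ k.+1) W); last by exists set0; split=> //; left.
  by have [_ /(_ k i erefl)[V [AV WV]]] := (BR _).1 _ BW; exists V.
exists b; split=> [i|x Cx]; first exact: (bP i).1.
move: (I : [set: X] x); rewrite -Bcov => -[W [m _ BW] Wx].
have [j jk gW] := gP _ _ BW; have jk' : j < k.+1 by apply: ltnW.
exists (m * k.+1 + j) => //; have [_ /=] := bP (m * k.+1 + j).
rewrite divnMDl // modnMDl modn_small // divn_small // addn0 gW.
by apply.
Qed.

(** * Compact sets *)

(** Compactness is characterized by open covers for pointed spaces; if [K] is
    nonempty, any of its points provides the base point. *)
Lemma compact_finite_subcover {X : topologicalType} (K : set X)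
    (A : set (set X)) :
  compact K -> A `<=` open -> K `<=` \bigcup_(U in A) U ->
  exists2 F : {fset set X}, [set` F] `<=` A & K `<=` \bigcup_(U in [set` F]) U.
Proof.
move=> cptK Aop AK; have [->|/set0P[x0 _]] := eqVneq K set0.
  by exists fset0 => // x.
pose Xp : ptopologicalType :=
  HB.pack (Topological.sort X) (isPointed.Build X x0).
have : @cover_compact Xp K by rewrite -compact_cover; exact: cptK.
move=> /(_ (set X) A id Aop AK)[F FA KF]; exists F => // U FU.
by apply/set_mem/FA.
Qed.

(** * The two implications *)

Definition rothberger_kernel (X : topologicalType) : set X :=
  [set x | forall U, open U -> U x -> ~ rothberger (closure U)].

Lemma compact_rothberger_kernel {X : topologicalType} :
  regular_space X -> S_bnd X -> compact (rothberger_kernel X).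
Proof.
move=> regX SX F PF FK; apply: contrapT => nK.
pose A := [set U : set X | open U /\ exists2 E, F E & closure U `&` E = set0].
have [||U [AU Ucov]] := S_bnd_countable_subcover A SX.
- split=> [U []//|]; apply/seteqP; split=> // x _.
  have [G Gx [E FE GE]] : exists2 G, nbhs x G & exists2 E, F E & G `&` E = set0.
    have [Kx|nKx] := pselect (rothberger_kernel X x).
      apply: contrapT => nG; apply: nK; exists x; split=> // E G FE Gx.
      apply: contrapT => /set0P/negP/negPn/eqP EG0.
      by apply: nG; exists G => //; exists E => //; rewrite setIC.
    have /existsNP[U /not_implyP[oU /not_implyP[Ux /contrapT rU]]] := nKx.
    exists U; first exact: open_nbhs_nbhs.
    exists (rothberger_kernel X) => //.
    by apply/seteqP; split=> // y [Uy Ky]; exact: (Ky U).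
  have [V Vx VG] := regX _ _ Gx.
  exists V°; last exact: Vx.
  split; first exact: open_interior.
  exists E => //; apply/seteqP; split=> // y [Vy Ey]; rewrite -GE; split=> //.
  by apply: VG; apply: closureS Vy; exact: interior_subset.
- split; first exact: open0.
  by exists setT; [exact: filterT|rewrite closure0 set0I].
have [n rn] := S_bnd_escape U SX (fun n => (AU n).1) Ucov.
have FN : F (~` \bigcup_(i < n) closure (U i)).
  elim: n {rn} => [|n IH].
    by rewrite bigcup_mkord big_ord0 setC0; exact: filterT.
  have [_ [E FE UE]] := AU n.
  apply: filterS (filterI IH FE) => y [ny Ey] [i /= lin Uy].
  move: lin; rewrite ltnS leq_eqVlt => /orP[/eqP ein|lin].
    have : (closure (U n) `&` E) y by rewrite -ein.
    by rewrite UE.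
  by apply: ny; exists i.
(* A point of [K] off the finitely many closures would have an open
   neighbourhood whose closure lies in the closed set of [rn]. *)
have [x [Kx nx]] := filter_ex (filterI FK FN).
apply: (Kx (~` \bigcup_(i < n) closure (U i))) => //.
  apply: closed_openC; apply: closed_bigcup; first exact: finite_II.
  by move=> i _; exact: closed_closure.
apply: rothberger_closed rn; first exact: closed_closure.
have /closure_id -> : closed (~` \bigcup_(i < n) U i).
  by apply: open_closedC; apply: bigcup_open => i _; exact: (AU i).1.
apply: closureS => y ny [i lin Uy]; apply: ny; exists i => //.
exact: subset_closure.
Qed.

(** Off [V] each point has a neighbourhood whose closure admits one-set
    selections; by the Lindelof property countably many of them suffice. *)
Lemma rothberger_off_kernel {X : topologicalType} (V : set X) :
  S_bnd X -> open V -> rothberger_kernel X `<=` V -> rothberger (~` V).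
Proof.
move=> SX oV KV.
(* The sets [D] let the parts of the cover lying inside [V], which contribute
   nothing to the complement of [V], be treated like the others. *)
pose A := [set U : set X | open U /\
  exists D, [/\ U `\` V `<=` D, D `<=` ~` V & rothberger D]].
have [||U [AU Ucov]] := S_bnd_countable_subcover A SX.
- split=> [U []//|]; apply/seteqP; split=> // x _.
  have [Vx|nVx] := pselect (V x).
    exists V => //; split=> //; exists set0.
    by split=> //; [move=> y []|exact: rothberger0].
  have /existsNP[U /not_implyP[oU /not_implyP[Ux /contrapT rU]]] :
    ~ rothberger_kernel X x by move=> /KV.
  exists U => //; split=> //; exists (closure U `&` ~` V); split.
  + by apply: setSI; exact: subset_closure.
  + by move=> y [].
  + apply: rothberger_closed rU; last by move=> y [].
    by apply: closedI; [exact: closed_closure|exact: open_closedC].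
- split; first exact: open0.
  by exists set0; split=> //; exact: rothberger0.
have /choice[D DP] n := (AU n).2.
have -> : ~` V = \bigcup_n D n.
  apply/seteqP; split=> [x nVx|x [n _]]; last by have [_ + _] := DP n; exact.
  move: (I : [set: X] x); rewrite -Ucov => -[n _ Ux]; exists n => //.
  by have [+ _ _] := DP n; apply.
by apply: rothberger_bigcup => n; have [] := DP n.
Qed.

Lemma S_bnd_of_compact {X : topologicalType} (K : set X) : compact K ->
  (forall V, open V -> K `<=` V -> rothberger (~` V)) -> S_bnd X.
Proof.
move=> cptK rK A Acov.
have AX n x : (\bigcup_(U in A n) U) x by rewrite (Acov n).2.
have [F FA KF] := compact_finite_subcover K (A 0) cptK (Acov 0).1 (fun x _ => AX 0 x).
have [|n|n x _|b [bA bV]] := rK (\bigcup_(U in [set` F]) U) _ KF A.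
- by apply: bigcup_open => U /FA; exact: (Acov 0).1.
- exact: (Acov n).1.
- exact: AX.
exists (fun n => [set U | A n U /\ (U = b n \/ n = 0 /\ U \in F)]), (#|` F|).+1.
split=> [n|].
  split=> [U []//|]; pose G := (b n |` F)%fset.
  apply: (@card_le_trans _ _ _ [set` G]).
    apply: subset_card_le => U [_ UF] /=; rewrite !inE.
    by case: UF => [->|[_ ->]]; rewrite ?eqxx ?orbT.
  have /card_eq_fsetP GE : #|` G| = #|` G| by [].
  rewrite (card_le_eql GE) card_le_II /G cardfsU1.
  by case: (_ \notin _); rewrite ?add1n ?add0n.
split=> [U [n _ [AU _]]|]; first exact: (Acov n).1.
apply/seteqP; split=> // x _.
have [[U FU Ux]|nVx] := pselect ((\bigcup_(U in [set` F]) U) x).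
  by exists U => //; exists 0 => //; split; [exact: FA|right].
have [n _ bx] := bV _ nVx; exists (b n) => //; exists n => //.
by split; [have [b0|//] := bA n; rewrite b0 in bx|left].
Qed.

Theorem corollary5p9 (X : topologicalType) (hX : @regular_space X) :
  S_bnd X <->
  exists K : set X, compact K /\
    forall V : set X, open V -> K `<=` V -> S_one (set_type (~` V)).
Proof.
split=> [SX|[K [cptK rK]]].
  exists (rothberger_kernel X); split; first exact: compact_rothberger_kernel.
  by move=> V oV KV; apply/rothberger_S_one; exact: rothberger_off_kernel.
apply: S_bnd_of_compact cptK _ => V oV KV.
by apply/rothberger_S_one; exact: rK.
Qed.
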